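(* Let $-1<b<0$, let $x^*=\frac{1}{b-1}$, and let $\epsilon>0$. Put $$I_0(b,\epsilon)=(bx^*-\epsilon,\;bx^*-|b|\epsilon]\;\cup\;[bx^*+|b|\epsilon,\;bx^*+\epsilon).$$ Then for every function $y_0:I_0(b,\epsilon)\to\mathbb{R}$, the initial value problem for the functional equation $y(x+1)=y(bx)$ with initial condition $y(x)=y_0(x)$ for $x\in I_0(b,\epsilon)$ has a unique solution on $\mathbb{R}\setminus\{bx^*\}$; it is the unique extension of $y_0$ to a solution on $\mathbb{R}\setminus\{bx^*\}$.
   Context: A solution of the initial value problem on a set $J\subseteq\mathbb{R}$ is a function $y:J\to\mathbb{R}$ that satisfies $y(x+1)=y(bx)$ for all real $x$ with $x+1\in J$ and $bx\in J$, and agrees with the initial function on its domain. No continuity is assumed. The point $x^*=\frac1{b-1}$ is the solution of $x+1=bx$, so $bx^*=x^*+1$. *)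

(* Defs.v *)
From HB Require Import structures.
From mathcomp Require Import all_boot all_order all_algebra.
From mathcomp Require Import all_classical all_reals.

Set Implicit Arguments.
Unset Strict Implicit.
Unset Printing Implicit Defensive.

Import Order.TTheory GRing.Theory Num.Theory.

Local Open Scope classical_set_scope.
Local Open Scope ring_scope.

(* A function on J : set R is a function on the subtype of elements of J
   (coercion [set_type]); [\val] is the inclusion of J into R. *)

Definition is_solution {R : realType} (b : R) (J : set R) (y : J -> R) : Prop :=
  forall (x : R) (u v : J), \val u = x + 1 -> \val v = b * x -> y u = y v.

(* In particular I is contained in J. *)
Definition extends {R : realType} (I J : set R) (y0 : I -> R) (y : J -> R) :
    Prop :=
  forall v : I, exists2 u : J, \val u = \val v & y u = y0 v.

Definition is_ivp_solution {R : realType} (b : R) (I J : set R) (y0 : I -> R)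
    (y : J -> R) : Prop :=
  is_solution b y /\ extends y0 y.

Definition xstar {R : realType} (b : R) : R := 1 / (b - 1).

Definition I0 {R : realType} (b eps : R) : set R :=
  [set` `]b * xstar b - eps, b * xstar b - `|b| * eps]]
  `|` [set` `[b * xstar b + `|b| * eps, b * xstar b + eps[].

(* Main.v *)
(** In the coordinate [t = x - b x*] centred at [b x* = x* + 1], the equation
    [y (x + 1) = y (b x)] says that [y] is invariant under [t |-> b t].
    Since [0 < |b| < 1], every orbit of this map on the nonzero reals (under
    positive and negative powers) meets the annulus [|b| eps <= |t| < eps],
    which is [I0], exactly once. So [y0] extends uniquely to a function that is
    constant on orbits. *)
Require Import Defs.
From mathcomp Require Import all_boot all_order all_algebra.
From mathcomp Require Import all_classical all_reals.
From mathcomp Require Import ring lra.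

Import Order.TTheory GRing.Theory Num.Theory.

Local Open Scope classical_set_scope.
Local Open Scope ring_scope.

Lemma exprn_unbounded {R : realType} {x : R} (y : R) :
  1 < x -> exists n : nat, y < x ^+ n.
Proof.
move=> x1; have d0 : 0 < x - 1 by rewrite subr_gt0.
have bernoulli n : n%:R * (x - 1) <= x ^+ n.
  elim: n => [|n IHn]; first by rewrite mul0r expr0.
  have xn1 : 1 <= x ^+ n by rewrite exprn_ege1 // ltW.
  by rewrite exprS -natr1; nra.
exists (Num.bound `|y / (x - 1)|); apply: lt_le_trans (bernoulli _).
rewrite -ltr_pdivrMr //; apply: le_lt_trans (ler_norm _) _.
exact: archi_boundP (normr_ge0 _).
Qed.

(** Since [a ^ n * s] decreases in [n], take the least [n] bringing it below 1: the previous value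
    is at least 1, so one more factor [a] leaves it at least [a]. *)
Lemma exprz_fundamental_domain {R : realType} {a s : R} :
  0 < a -> a < 1 -> 0 < s -> exists n : int, a <= a ^ n * s < 1.
Proof.
move=> a0 a1 s0; have A1 : 1 < a^-1 by rewrite invf_gt1.
have [N sN] := exprn_unbounded s A1.
have [M sM] := exprn_unbounded s^-1 A1.
have a_neq0 : a != 0 by rewrite gt_eqF.
(* The shift by [M] turns the search over integers into one over naturals: [P 0] fails by the choice
   of [M], so the least [k] has a predecessor. *)
pose P k := a ^ (k%:Z - M%:Z) * s < 1.
have exP : exists k, P k.
  exists (M + N)%N; rewrite /P PoszD addrAC subrr add0r -exprnP.
  by rewrite mulrC -ltr_pdivlMr ?exprn_gt0 // div1r -exprVn.
case: (ex_minnP exP) => -[|k] Pk minP.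
  move: Pk; rewrite /P sub0r -invr_expz -exprnP -exprVn.
  by rewrite -ltr_pdivlMr // div1r => /lt_trans/(_ sM); rewrite ltxx.
exists (k.+1%:Z - M%:Z); rewrite [X in _ && X]Pk andbT.
have: ~~ P k by apply/negP => /minP; rewrite ltnn.
rewrite /P -leNgt => ge1.
by rewrite -addn1 PoszD addrAC expfzDr // expr1z mulrAC ler_peMl // ltW.
Qed.

(** If [m < n], then [a ^ n * s <= a * (a ^ m * s) < a], so the larger exponent falls below the
    interval. *)
Lemma exprz_fundamental_domain_inj {R : realType} {a s : R} {m n : int} :
  0 < a -> a < 1 -> 0 < s ->
  a <= a ^ m * s < 1 -> a <= a ^ n * s < 1 -> m = n.
Proof.
move=> a0 a1 s0.
wlog lt_mn : m n / m < n => [hwlog hm hn|].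
  by case: (ltgtP m n) => // lt; [|apply/esym]; exact: hwlog.
move=> /andP[_ hm] /andP[hn _].
have a_le j : (0 <= j)%R -> a ^ (j : int) <= 1.
  by case: j => // j _; rewrite -exprnP exprn_ile1 // ltW.
have := a_le (n - (m + 1)); rewrite subr_ge0 lezD1 => /(_ lt_mn) aj1.
have eq_n : a ^ n = a ^ (n - (m + 1)) * (a * a ^ m).
  by rewrite -{3}(expr1z a) -!expfzDr ?gt_eqF //; congr (a ^ _); ring.
have am0 : 0 < a ^ m by rewrite exprz_gt0.
suff : a ^ n * s < a by rewrite ltNge hn.
rewrite eq_n -!mulrA (le_lt_trans (ler_piMl _ aj1)) //.
  by rewrite !mulr_ge0 // ltW.
by rewrite gtr_pMr.
Qed.

Lemma normr_exprz {R : realFieldType} (x : R) (n : int) : `|x ^ n| = `|x| ^ n.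
Proof.
case: n => n; first exact: normrX.
by rewrite NegzE -!invr_expz normfV -!exprnP normrX.
Qed.

(** The absolute value folds the two half-open pieces into one interval, the fundamental domain
    above with [a] equal to [|b|]. *)
Lemma mem_I0 {R : realType} (b eps x : R) :
  `|b| < 1 -> 0 < eps ->
  I0 b eps x <-> `|b| <= `|x - b * xstar b| / eps < 1.
Proof.
move=> b1 e0; rewrite ler_pdivlMr // ltr_pdivrMr // mul1r.
have b0 := normr_ge0 b; set a := `|b| in b0 b1 *; set c := b * xstar b.
rewrite /I0 -/a -/c /= !in_itv /=; split.
- have ae0 : 0 <= a * eps by rewrite mulr_ge0 // ltW.
  move=> [/andP[h1 h2]|/andP[h1 h2]].
  + by rewrite ler0_norm; [apply/andP; split|]; lra.
  + by rewrite ger0_norm; [apply/andP; split|]; lra.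
- case: (ger0P (x - c)) => h /andP[h1 h2]; [right|left];
  by apply/andP; split; lra.
Qed.

Lemma mul_xstar {R : realType} (b : R) : b < 0 -> b * xstar b = xstar b + 1.
Proof.
move=> b0; have b1 : b - 1 != 0 by rewrite lt_eqF // subr_lt0 (lt_trans b0).
by rewrite /xstar; field.
Qed.

Lemma mul_sub_center {R : realType} (b x : R) :
  b < 0 -> b * x - b * xstar b = b * (x + 1 - b * xstar b).
Proof. by move=> b0; rewrite [in RHS]mul_xstar //; ring. Qed.

Lemma solution_scale {R : realType} (b : R) (y : [set~ b * xstar b] -> R)
    (u v : [set~ b * xstar b]) :
  b < 0 -> is_solution b y ->
  \val v - b * xstar b = b * (\val u - b * xstar b) -> y u = y v.
Proof.
set c := b * xstar b => b0 ysol uv; apply: (ysol (\val u - 1)); first by rewrite subrK.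
by apply: (addIr (- c)); rewrite uv mul_sub_center // subrK.
Qed.

Lemma solution_orbit {R : realType} (b : R) (y : [set~ b * xstar b] -> R)
    (n : int) (u v : [set~ b * xstar b]) :
  b < 0 -> is_solution b y ->
  \val v - b * xstar b = b ^ n * (\val u - b * xstar b) -> y u = y v.
Proof.
set c := b * xstar b => b0 ysol.
have b_neq0 : b != 0 by rewrite lt_eqF.
have nat_orbit (k : nat) (u' v' : [set~ c]) :
    \val v' - c = b ^+ k * (\val u' - c) -> y u' = y v'.
  elim: k v' => [|k IHk] v' uv.
    by move: uv; rewrite mul1r => /addIr /val_inj ->.
  (* The orbit never hits the removed point, so the induction stays in the domain. *)
  have wP : c + b ^+ k * (\val u' - c) \in [set~ c].
    rewrite inE => /eqP; rewrite -subr_eq0 addrC addKr mulf_eq0 expf_eq0.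
    rewrite (negbTE b_neq0) andbF /= subr_eq0 => /eqP.
    exact: (set_valP u').
  pose w : [set~ c] := SigSub wP.
  have wE : \val w - c = b ^+ k * (\val u' - c) by rewrite /= addrC addKr.
  by rewrite (IHk w wE); apply: solution_scale => //; rewrite wE uv exprS mulrA.
case: n => [k|k]; first exact: nat_orbit.
(* A negative exponent is a positive one with [u] and [v] exchanged. *)
rewrite NegzE -invr_expz -exprnP => uv; apply/esym/(nat_orbit k.+1).
by rewrite uv mulrA divff ?mul1r // expf_neq0.
Qed.

Theorem theorem2p14 (R : realType) (b eps : R) (hb1 : -1 < b) (hb0 : b < 0)
    (heps : 0 < eps) (y0 : I0 b eps -> R) :
  exists! y : [set~ b * xstar b] -> R, is_ivp_solution b y0 y.
Proof.
set c := b * xstar b.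
have b_neq0 : b != 0 by rewrite lt_eqF.
have a0 : 0 < `|b| by rewrite normr_gt0.
have a1 : `|b| < 1 by rewrite ltr_norml hb1 (lt_trans hb0).
have s0 (u : [set~ c]) : 0 < `|\val u - c| / eps.
  rewrite divr_gt0 // normr_gt0 subr_eq0; apply/eqP; exact: (set_valP u).
have memE (n : int) (x t : R) : x - c = b ^ n * t ->
    I0 b eps x <-> `|b| <= `|b| ^ n * (`|t| / eps) < 1.
  by move=> xt; rewrite mem_I0 // -/c xt normrM normr_exprz mulrA.
have repP (u : [set~ c]) : exists v : I0 b eps,
    exists n : int, \val v - c = b ^ n * (\val u - c).
  have [n nP] := exprz_fundamental_domain a0 a1 (s0 u).
  have xE : c + b ^ n * (\val u - c) - c = b ^ n * (\val u - c).
    by rewrite addrC addKr.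
  have vP : c + b ^ n * (\val u - c) \in I0 b eps.
    by rewrite inE; apply/(memE _ _ _ xE).
  by exists (SigSub vP), n.
have rep_inj (u : [set~ c]) (v w : I0 b eps) (m n : int) :
    \val v - c = b ^ m * (\val u - c) -> \val w - c = b ^ n * (\val u - c) ->
    v = w.
  (* Absolute values lose the sign of [b], but they determine the exponent, which in turn determines
     the signed point. *)
  move=> vE wE; apply/val_inj/(addIr (- c)); rewrite vE wE; congr (b ^ _ * _).
  apply: (exprz_fundamental_domain_inj a0 a1 (s0 u)).
    exact: (proj1 (memE _ _ _ vE) (set_valP v)).
  exact: (proj1 (memE _ _ _ wE) (set_valP w)).
have [rep rep_orbit] := choice repP.
have I0_neq (v : I0 b eps) : \val v \in [set~ c].
  rewrite inE => vc; have := set_valP v; rewrite mem_I0 // -/c vc subrr normr0.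
  by rewrite mul0r leNgt a0.
exists (y0 \o rep); split; [split|].
- move=> x u v uE vE /=; congr y0.
  have [m mE] := rep_orbit u; have [n nE] := rep_orbit v.
  (* Here [v] is one step after [u] on the orbit, so [rep v] also represents [u], with exponent
     [n + 1]. *)
  apply: (rep_inj u _ _ m (n + 1)) => //.
  by rewrite nE vE uE mul_sub_center // expfzDr // expr1z mulrA.
- move=> v; exists (SigSub (I0_neq v)) => //=; congr y0.
  have [n nE] := rep_orbit (SigSub (I0_neq v)).
  (* A point of [I0] represents itself, with exponent 0. *)
  by apply: (rep_inj (SigSub (I0_neq v)) _ _ n 0) => //; rewrite expr0z mul1r.
- move=> y [ysol yext]; apply/funext => u /=.
  (* Any solution is constant along the orbit from [u] to [rep u], where [y0] prescribes its
     value. *)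
  have [n nE] := rep_orbit u; have [w wE <-] := yext (rep u).
  by apply/esym/(solution_orbit _ _ n _ _ hb0 ysol); rewrite wE.
Qed.
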